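(* Assume that $\hat G \to^p G$ as $T\to\infty$ for some positive definite symmetric random matrix $G$, and that $r_T^{-1}(\tilde\theta-\theta^* )=O_p(1)$. If $r_T^{-1}a_T=O_p(1)$ and $r_T^{-(2-q)}b_T\to^p\infty$, then $$P\big[\hat\theta^{(q)}_{\mathcal J^0}=0\big]\to1 .$$
   Context: Let $(\Omega,\mathcal F,P)$ be a probability space, $\mathsf p$ a positive integer, $0<q\le 1$, and $(r_T)_T$ a sequence of positive numbers tending to $0$ as $T\to\infty$. All limits are as $T\to\infty$. The parameter is $\theta\in\mathbb R^{\mathsf p}$ with true value $\theta^*=[\theta_1^*,\dots,\theta_{\mathsf p}^*]'$ (prime denotes transpose), ordered so that $\theta_1^*\neq0,\dots,\theta^*_{\mathsf p^0}\neq 0$ and $\theta^*_{\mathsf p^0+1}=\dots=\theta^*_{\mathsf p}=0$. For each $T$, $\tilde\theta=\tilde\theta_T$ is an $\mathbb R^{\mathsf p}$-valued random vector (initial estimator), $\hat G=\hat G_T$ is a $\mathsf p\times\mathsf p$ almost surely positive definite symmetric random matrix, and $\kappa_T^j$ ($1\le j\le\mathsf p$) are nonnegative random variables. Define $$Q_T^{(q)}(\theta)=(\theta-\tilde\theta)'\hat G(\theta-\tilde\theta)+\sum_{j=1}^{\mathsf p}\kappa_T^j|\theta_j|^q,$$ and let $\hat\theta^{(q)}$ (the penalized LSA estimator, depending on $T$) be a random vector minimizing $Q_T^{(q)}$ over $\mathbb R^{\mathsf p}$. Put $a_T=\max\{\kappa_T^j: j\le\mathsf p^0\}$ and $b_T=\min\{\kappa_T^j:j>\mathsf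 p^0\}$ (with $\max\emptyset=0$, $\min\emptyset=+\infty$). For $v\in\mathbb R^{\mathsf p}$, $v_{\mathcal J^0}=[v_{\mathsf p^0+1},\dots,v_{\mathsf p}]'$. *)

(* Defs.v *)
From HB Require Import structures.
From mathcomp Require Import all_boot all_order all_algebra.
From mathcomp Require Import all_classical all_reals all_analysis.

Set Implicit Arguments.
Unset Strict Implicit.
Unset Printing Implicit Defensive.

Import Order.TTheory GRing.Theory Num.Theory.
Import numFieldNormedType.Exports.

Local Open Scope classical_set_scope.
Local Open Scope ring_scope.

Definition random_mx d (Omega : measurableType d) (R : realType) (m n : nat)
    (X : Omega -> 'M[R]_(m, n)) : Prop :=
  forall i j, measurable_fun setT (fun w => X w i j).

Definition symposdef (R : realType) (p : nat) (A : 'M[R]_p) : Prop :=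
  A^T = A /\ forall x : 'cV[R]_p, x != 0 -> 0 < (x^T *m A *m x) 0 0.

Section modes_of_convergence.
Context d (Omega : measurableType d) (R : realType) (P : probability Omega R).
Context (I : Type) (F : set_system I).

(* On matrices `|_| is the entrywise maximum norm; as all norms are equivalent
   in finite dimension, the two notions below do not depend on this choice. *)
Definition cvg_in_prob (V : normedZmodType R) (X : I -> Omega -> V)
    (Y : Omega -> V) : Prop :=
  forall e : R, 0 < e -> P [set w | e < `|X t w - Y w|] @[t --> F] --> 0%E.

Definition bounded_in_prob (V : normedZmodType R) (X : I -> Omega -> V) : Prop :=
  forall e : R, 0 < e ->
    exists M : R, \forall t \near F, (P [set w | (M < `|X t w|)%R] <= e%:E)%E.

Definition cvg_pinfty_in_prob (X : I -> Omega -> \bar R) : Prop :=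
  forall M : R, P [set w | (M%:E < X t w)%E] @[t --> F] --> 1%E.

End modes_of_convergence.

(* theta is a column vector: its j-th coordinate is theta j 0. Since
   0 `^ q = 0 for q != 0, the power agrees with |theta_j|^q at theta_j = 0. *)
Definition penalized_lsa (R : realType) (p : nat) (q : R) (G : 'M[R]_p)
    (thetat : 'cV[R]_p) (kappa : 'I_p -> R) (theta : 'cV[R]_p) : R :=
  ((theta - thetat)^T *m G *m (theta - thetat)) 0 0
  + \sum_(j < p) kappa j * `|theta j 0| `^ q.

(* In 0-based indexing, the coordinates 1, ..., p0 are the j with j < p0. *)
Definition max_active (R : realType) (p p0 : nat) (kappa : 'I_p -> R) : R :=
  \big[Order.max/0]_(j < p | (j < p0)%N) kappa j.

Definition min_inactive (R : realType) (p p0 : nat) (kappa : 'I_p -> R) :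
    \bar R :=
  \big[Order.min/+oo%E]_(j < p | (p0 <= j)%N) (kappa j)%:E.

(* Main.v *)
Require Import Defs.
From HB Require Import structures.
From mathcomp Require Import all_boot all_order all_algebra.
From mathcomp Require Import all_classical all_reals all_analysis.
From mathcomp Require Import measurable_realfun ring lra.

Set Implicit Arguments.
Unset Strict Implicit.
Unset Printing Implicit Defensive.

Import Order.TTheory GRing.Theory Num.Theory.
Import numFieldNormedType.Exports.

Local Open Scope classical_set_scope.
Local Open Scope ring_scope.

(* All events hold with probability close to 1, uniformly for large T.
   Comparing the minimizer with theta* gives an inequality
   lam y^2 <= a r_T^2 + b r_T y for y = |thetahat - thetat|, whence
   thetahat - theta* = O(r_T); here |theta*_j|^q - |x|^q <= |theta*_j|^(q-1) |x - theta*_j|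
   bounds the gain in the active penalties by O(a_T) |thetahat - theta*|.
   Comparing the minimizer with the vector obtained by zeroing its coordinate
   c = thetahat_j, j inactive, gives kappa_j |c|^q <= O(r_T) |c|.  If c <> 0
   then kappa_j <= O(r_T) |c|^(1-q) = O(r_T^(2-q)), which contradicts
   r_T^-(2-q) b_T -> oo.  The smallest eigenvalue of the limit G is bounded below
   through det(G) and adj(G), which are measurable and need no compactness
   argument on the unit sphere. *)

(** * Bilinear forms of symmetric positive definite matrices *)

Section bilinear_form.
Context {R : realType} {p : nat}.
Implicit Types (A : 'M[R]_p) (x y z : 'cV[R]_p).

Definition bform A x y : R := (x^T *m A *m y) 0 0.

Lemma bformDl A x y z : bform A (x + y) z = bform A x z + bform A y z.
Proof. by rewrite /bform linearD/= !mulmxDl mxE. Qed.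

Lemma bformDr A x y z : bform A x (y + z) = bform A x y + bform A x z.
Proof. by rewrite /bform mulmxDr mxE. Qed.

Lemma bformZl A a x y : bform A (a *: x) y = a * bform A x y.
Proof. by rewrite /bform linearZ/= -!scalemxAl mxE. Qed.

Lemma bformZr A a x y : bform A x (a *: y) = a * bform A x y.
Proof. by rewrite /bform -scalemxAr mxE. Qed.

Lemma bformDm A B x y : bform (A + B) x y = bform A x y + bform B x y.
Proof. by rewrite /bform mulmxDr mulmxDl mxE. Qed.

Lemma bform_sym A x y : A^T = A -> bform A x y = bform A y x.
Proof.
move=> sA; rewrite /bform -[in RHS](trmxK (y^T *m A *m x)) [RHS]mxE.
by rewrite !trmx_mul trmxK sA mulmxA.
Qed.


Lemma ler_norm_entry m n (A : 'M[R]_(m, n)) i j : `|A i j| <= `|A|.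
Proof.
by rewrite [leRHS]/Num.Def.normr/= mx_normrE
  (le_bigmax _ (fun ij => `|A ij.1 ij.2|) (i, j)).
Qed.

(** The factor [p%:R ^+ 2] counts the terms of the double sum, each of which is bounded through
    entrywise maximum norms. *)
Lemma ler_norm_bform A x y : `|bform A x y| <= p%:R ^+ 2 * `|A| * `|x| * `|y|.
Proof.
rewrite /bform mxE (le_trans (ler_norm_sum _ _ _))//.
have -> (a b c : R) : p%:R ^+ 2 * a * b * c = \sum_(i < p) \sum_(k < p) b * a * c.
  by rewrite !sumr_const !card_ord -[RHS]mulr_natl -[b * a * c *+ p]mulr_natl; ring.
apply: ler_sum => i _; rewrite normrM -mulr_suml ler_pM ?ler_norm_entry//.
rewrite mxE (le_trans (ler_norm_sum _ _ _))//; apply: ler_sum => k _.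
by rewrite normrM ler_pM ?mxE ?ler_norm_entry.
Qed.

Lemma symposdef_ge0 A x : symposdef A -> 0 <= bform A x x.
Proof.
move=> [_ A_gt0]; have [->|/A_gt0/ltW//] := eqVneq x 0.
by rewrite /bform mulmx0 mxE.
Qed.

Lemma symposdef_CauchySchwarz A x y : symposdef A ->
  bform A x y ^+ 2 <= bform A x x * bform A y y.
Proof.
move=> pA; have [sA A_gt0] := pA; have [->|y0] := eqVneq y 0.
  by rewrite /bform !mulmx0 mxE expr0n mulr0.
have c_gt0 : 0 < bform A y y by exact: A_gt0.
(* At this vector the form equals [bform A y y] times the gap in the claimed inequality, and
   [bform A y y] is positive. *)
have := symposdef_ge0 (bform A y y *: x + - bform A x y *: y) pA.
rewrite !(bformDl, bformDr, bformZl, bformZr) (bform_sym y x sA) => h.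
rewrite -subr_ge0 -(pmulr_rge0 _ c_gt0); apply: le_trans h _.
by rewrite le_eqVlt; apply/orP; left; apply/eqP; ring.
Qed.

Lemma symposdef_det_neq0 A : symposdef A -> \det A != 0.
Proof.
move=> [_ A_gt0]; apply/negP => /det0P[v v0 vA0].
have := A_gt0 v^T; rewrite trmxK vA0 mul0mx mxE ltxx => /(_ _)/notF; apply.
by apply: contraNneq v0 => /(congr1 trmx); rewrite trmxK trmx0 => ->.
Qed.

Lemma normmx_attained m n (A : 'M[R]_(m, n)) :
  A != 0 -> exists i j, `|A| = `|A i j|.
Proof.
rewrite -normr_eq0 => /mx_norm_neq0[[i j] Aij]; by exists i, j.
Qed.

(* With y = adj(A) e_j one has x'Ay = det(A) x_j and y'Ay = det(A) adj(A)_jj,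
   so this is the Cauchy-Schwarz inequality for x and y. *)
Lemma symposdef_coercive A x : symposdef A ->
  `|\det A| * `|x| ^+ 2 <= `|\adj A| * bform A x x.
Proof.
move=> pA; have [->|/normmx_attained[j [k ->]]] := eqVneq x 0.
  by rewrite normr0 expr0n mulr0 mulr_ge0 ?symposdef_ge0.
rewrite (ord1 k) {k}.
pose y := \adj A *m delta_mx j 0 : 'cV_p.
have bE z : bform A z y = \det A * z j 0.
  rewrite /bform -mulmxA [A *m _]mulmxA mul_mx_adj mul_scalar_mx -scalemxAr.
  by rewrite -colE !mxE.
have yj : y j 0 = \adj A j j by rewrite /y -colE mxE.
have := symposdef_CauchySchwarz x y pA.
have d_gt0 : 0 < `|\det A| by rewrite normr_gt0 symposdef_det_neq0.
rewrite !bE yj -[_ ^+ 2]ger0_norm ?sqr_ge0// normrX normrM exprMn => h.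
(* Cauchy-Schwarz carries one factor of the determinant more than the claim, so both sides are first
   multiplied by its absolute value. *)
rewrite -(ler_pM2l d_gt0) mulrA -expr2 (le_trans h)//.
rewrite [leRHS]mulrA [leRHS]mulrC ler_wpM2l ?symposdef_ge0//.
by rewrite (le_trans (ler_norm _))// normrM ler_pM2l// ler_norm_entry.
Qed.

End bilinear_form.

(** * Two scalar inequalities *)

Lemma powR_sub_le (R : realType) (q a b : R) : 0 < q -> q <= 1 -> 0 < a ->
  0 <= b -> a `^ q - b `^ q <= a `^ (q - 1) * `|b - a|.
Proof.
move=> q_gt0 q_le1 a_gt0 b_ge0; have [ab|ba] := leP a b.
  rewrite (@le_trans _ _ 0) ?mulr_ge0 ?powR_ge0// subr_le0.
  by rewrite ge0_ler_powR ?nnegrE ?(ltW q_gt0) ?(ltW a_gt0).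
(* For [b < a] both powers are split as x^q = x^(q-1) x. Since [q - 1] is at most 0, b^(q-1)
   dominates a^(q-1) when b is positive. *)
have -> : a `^ q = a `^ (q - 1) * a.
  by rewrite -[X in _ * X]powRr1 ?ltW// -powRD ?subrK// lt0r_neq0 ?implybT.
rewrite distrC gtr0_norm ?subr_gt0// mulrBr lerD2l lerN2.
have [->|b_neq0] := eqVneq b 0; first by rewrite mulr0 powR_ge0.
have b_gt0 : 0 < b by rewrite lt0r b_neq0.
have -> : b `^ q = b `^ (q - 1) * b.
  by rewrite -[X in _ * X]powRr1 ?ltW// -powRD ?subrK// lt0r_neq0 ?implybT.
rewrite ler_pM2r// -opprB !powRN lef_pV2 ?posrE ?powR_gt0//.
by rewrite ge0_ler_powR ?nnegrE ?subr_ge0 ?(ltW a_gt0) ?(ltW ba).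
Qed.

(** Once y exceeds r, the term [a * r ^+ 2] is at most a r y, and dividing by y leaves l y <= (a +
    b) r. The summand 1 in the constant takes care of y <= r. *)
Lemma quadratic_root_le (R : realFieldType) (l a b r y : R) :
  0 < l -> 0 <= a -> 0 <= b -> 0 < r -> 0 <= y ->
  l * y ^+ 2 <= a * r ^+ 2 + b * r * y -> y <= (1 + (a + b) / l) * r.
Proof.
move=> l_gt0 a_ge0 b_ge0 r_gt0 y_ge0 h; rewrite leNgt; apply/negP => yr.
have ab_ge0 : 0 <= (a + b) / l by rewrite divr_ge0 ?addr_ge0// ltW.
have ry : r < y.
  by apply: le_lt_trans yr; rewrite ler_peMl ?(ltW r_gt0)// lerDl.
have y_gt0 : 0 < y by exact: lt_trans ry.
have : l * y ^+ 2 <= (a + b) * r * y.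
  apply: le_trans h _; rewrite !mulrDl lerD2r expr2 mulrA.
  by rewrite ler_wpM2l ?mulr_ge0 ?(ltW r_gt0) ?(ltW ry).
rewrite expr2 mulrA ler_pM2r// leNgt => /negP; apply.
have : l * ((1 + (a + b) / l) * r) = l * r + (a + b) * r.
  by field; exact: lt0r_neq0.
have := mulr_gt0 l_gt0 r_gt0; rewrite -(ltr_pM2l l_gt0) in yr; lra.
Qed.

(** * Deterministic estimates for a minimizer at a fixed good outcome *)

Section lsa_deterministic.
Context {R : realType} {p : nat}.
Variables (q lam Lam M : R) (p0 : nat) (thetas : 'cV[R]_p).
Hypotheses (q_gt0 : 0 < q) (q_le1 : q <= 1) (lam_gt0 : 0 < lam).
Hypotheses (Lam_ge0 : 0 <= Lam) (M_ge0 : 0 <= M).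
Hypothesis thetas_active : forall j : 'I_p, (j < p0)%N -> thetas j 0 != 0.
Hypothesis thetas_inactive : forall j : 'I_p, (p0 <= j)%N -> thetas j 0 = 0.

(** [C] sums the slopes given by [powR_sub_le] at the nonzero true coordinates. [L] is the constant
    of [quadratic_root_le] for a = p^2 Lam M^2 + C M^2 and b = C M. *)
Let C := \sum_(j < p | (j < p0)%N) `|thetas j 0| `^ (q - 1).
Let L := 1 + (p%:R ^+ 2 * Lam * M ^+ 2 + C * M ^+ 2 + C * M) / lam.

Let C_ge0 : 0 <= C. Proof. by apply: sumr_ge0 => j _; exact: powR_ge0. Qed.

Variables (r : R) (G : 'M[R]_p) (thetat : 'cV[R]_p) (kappa : 'I_p -> R).
Hypotheses (r_gt0 : 0 < r) (G_le : `|G| <= Lam).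
Hypothesis G_coercive : forall x, lam * `|x| ^+ 2 <= bform G x x.
Hypothesis thetat_near : `|thetat - thetas| <= M * r.
Hypothesis kappa_ge0 : forall j, 0 <= kappa j.
Hypothesis kappa_active : forall j : 'I_p, (j < p0)%N -> kappa j <= M * r.

Lemma ler_bform_Lam x y : `|bform G x y| <= p%:R ^+ 2 * Lam * `|x| * `|y|.
Proof.
rewrite (le_trans (ler_norm_bform _ _ _))// !ler_wpM2r// ler_wpM2l// sqr_ge0.
Qed.

Lemma penalty_gap (theta : 'cV[R]_p) :
  \sum_(j < p) kappa j * `|thetas j 0| `^ q
    - \sum_(j < p) kappa j * `|theta j 0| `^ q
  <= M * r * C * `|theta - thetas|.
Proof.
rewrite -sumrB mulr_sumr mulr_suml [leRHS]big_mkcond/=.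
apply: ler_sum => j _; case: ltnP => jp0.
  rewrite -mulrBr -!mulrA mulrA.
  apply: (@le_trans _ _ (kappa j * (`|thetas j 0| `^ (q - 1) * `|theta - thetas|))).
    rewrite ler_wpM2l// (le_trans (powR_sub_le _ _ _ _))// ?normr_gt0 ?thetas_active//.
    rewrite ler_wpM2l ?powR_ge0// (le_trans (ler_dist_dist _ _))//.
    by have := ler_norm_entry (theta - thetas) j 0; rewrite !mxE.
  by rewrite ler_wpM2r ?mulr_ge0 ?powR_ge0 ?kappa_active.
rewrite thetas_inactive// normr0 powR0 ?lt0r_neq0// mulr0 sub0r oppr_le0.
by rewrite mulr_ge0 ?powR_ge0.
Qed.

(** By coercivity it suffices to bound the form at [theta - thetat]. It is at most the form at
    [thetas - thetat], of order r^2, plus the penalty gap, whose distance to [thetas] is replaced by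
    the distance to [thetat] plus [M * r]. *)
Lemma lsa_rate (theta : 'cV[R]_p) :
  penalized_lsa q G thetat kappa theta <= penalized_lsa q G thetat kappa thetas ->
  `|theta - thetat| <= L * r.
Proof.
rewrite /penalized_lsa -!/(bform _ _ _) => theta_le.
apply: (quadratic_root_le lam_gt0) => //.
- by rewrite addr_ge0 ?mulr_ge0 ?sqr_ge0.
- by rewrite mulr_ge0.
rewrite (le_trans (G_coercive _))//.
have gap := penalty_gap theta.
have tri : `|theta - thetas| <= `|theta - thetat| + M * r.
  by rewrite (le_trans (ler_distD thetat _ _))// lerD2l.
have bs : bform G (thetas - thetat) (thetas - thetat) <=
    p%:R ^+ 2 * Lam * (M * r) * (M * r).
  rewrite (le_trans (ler_norm _))// (le_trans (ler_bform_Lam _ _))//.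
  by rewrite distrC ler_pM ?mulr_ge0 ?sqr_ge0// ler_wpM2l ?mulr_ge0 ?sqr_ge0.
have MrC_ge0 : 0 <= M * r * C by rewrite !mulr_ge0// ltW.
have := ler_wpM2l MrC_ge0 tri.
move: theta_le gap bs.
move: (bform _ _ _) (bform _ _ _) (\sum_(j < p) _) (\sum_(j < p) _).
move: (`|theta - thetas|) (`|theta - thetat|) => d y b1 b2 s1 s2.
move=> h1 h2 h3 h4; lra.
Qed.

Lemma lsa_coordinate (theta : 'cV[R]_p) (j : 'I_p) :
  (forall v, penalized_lsa q G thetat kappa theta <= penalized_lsa q G thetat kappa v) ->
  kappa j * `|theta j 0| `^ q <=
  p%:R ^+ 2 * Lam * `|theta j 0| * (2 * `|theta - thetat| + `|theta j 0|).
Proof.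
set c := theta j 0; set z := theta - thetat.
pose e : 'cV[R]_p := delta_mx j 0.
(* The competitor is [theta] with coordinate [j] set to zero. The other penalties cancel, and the
   quadratic form changes by two cross terms linear in [c] and one term in c^2. *)
move=> /(_ (theta - c *: e)); rewrite /penalized_lsa -!/(bform _ _ _).
rewrite addrAC -/z; clearbody z; rewrite (bigD1 j)//= [in leRHS](bigD1 j)//=.
rewrite !mxE !eqxx mulr1 subrr normr0 powR0 ?lt0r_neq0// mulr0 add0r.
rewrite [X in _ <= _ + X](_ : _ =
    \sum_(i < p | i != j) kappa i * `|theta i 0| `^ q); last first.
  by apply: eq_bigr => i ij; rewrite !mxE (negbTE ij) mulr0 subr0.
rewrite addrA lerD2r -scaleNr.
rewrite !(bformDl, bformDr, bformZl, bformZr) -/c => h.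
have e_le1 : `|e| <= 1.
  have [->|/normmx_attained[k [l ->]]] := eqVneq e 0; first by rewrite normr0.
  by rewrite !mxE; case: (_ && _); rewrite ?normr1 ?normr0.
pose K := p%:R ^+ 2 * Lam.
have K_ge0 : 0 <= K by rewrite mulr_ge0 ?sqr_ge0.
have bze : `|bform G z e| <= K * `|z|.
  by rewrite (le_trans (ler_bform_Lam _ _))// ler_piMr ?mulr_ge0.
have bez : `|bform G e z| <= K * `|z|.
  by rewrite (le_trans (ler_bform_Lam _ _))// ler_wpM2r// ler_piMr.
have bee : `|bform G e e| <= K.
  by rewrite (le_trans (ler_bform_Lam _ _))// -mulrA ler_piMr// mulr_ile1.
have cb b : c * b <= `|c| * `|b| by rewrite -normrM ler_norm.
have cN b : - c * b <= `|c| * `|b| by rewrite -normrN -normrM ler_norm.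
have h1 := le_trans (cN _) (ler_wpM2l (normr_ge0 c) bze).
have h2 := le_trans (cN _) (ler_wpM2l (normr_ge0 c) bez).
have h3 : - c * (- c * bform G e e) <= `|c| * (`|c| * K).
  apply: (le_trans (cN _)); rewrite ler_wpM2l// normrM normrN.
  by rewrite ler_wpM2l.
rewrite -/K; move: h h1 h2 h3; move: (`|c|) (`|z|) (_ `^ _) => c0 Z P.
move=> *; lra.
Qed.

(* (L + M) r bounds both |theta - thetat| and |theta - thetas|. *)
Definition lsa_threshold :=
  p%:R ^+ 2 * Lam * (3 * (L + M)) * (L + M) `^ (1 - q).

Lemma lsa_sparse (theta : 'cV[R]_p) (j : 'I_p) :
  (forall v, penalized_lsa q G thetat kappa theta <= penalized_lsa q G thetat kappa v) ->
  (p0 <= j)%N -> lsa_threshold * r `^ (2 - q) < kappa j -> theta j 0 = 0.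
Proof.
move=> theta_min jp0; apply: contraTeq => thetaj_neq0; rewrite -leNgt.
have L_ge0 : 0 <= L.
  by rewrite addr_ge0// divr_ge0 ?(ltW lam_gt0)// !addr_ge0 ?mulr_ge0 ?sqr_ge0.
pose B := L + M; have B_ge0 : 0 <= B by rewrite addr_ge0.
have rate := lsa_rate (theta_min thetas).
have near_t : `|theta - thetat| <= B * r.
  by rewrite (le_trans rate)// ler_pM2r// lerDl.
have near_s : `|theta j 0| <= B * r.
  have -> : theta j 0 = (theta - thetas) j 0.
    by rewrite !mxE thetas_inactive// subr0.
  rewrite (le_trans (ler_norm_entry _ _ _))// (le_trans (ler_distD thetat _ _))//.
  by rewrite mulrDl lerD.
have c_gt0 : 0 < `|theta j 0| by rewrite normr_gt0.
have cq_gt0 : 0 < `|theta j 0| `^ q by rewrite powR_gt0.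
rewrite -(ler_pM2r cq_gt0) (le_trans (lsa_coordinate j theta_min))//.
(* Splitting |c| = |c|^(1-q) |c|^q for c = [theta j 0] lets the positive factor |c|^q cancel against
   the penalty. *)
have -> : p%:R ^+ 2 * Lam * `|theta j 0| * (2 * `|theta - thetat| + `|theta j 0|) =
   p%:R ^+ 2 * Lam * (2 * `|theta - thetat| + `|theta j 0|) * `|theta j 0| `^ (1 - q)
    * `|theta j 0| `^ q.
  rewrite -[X in _ * X * (_ + _)]powRr1 ?ltW//.
  rewrite -[in LHS](subrK q 1) powRD ?subrK ?oner_eq0//; ring.
rewrite ler_pM2r// /lsa_threshold -/B.
(* The factor r joins [3 * B] to bound the sum of twice the error and the coordinate. The factor
   r^(1-q) joins B^(1-q) to bound the power of the coordinate, which is monotone because [1 - q] is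
   nonnegative. *)
have -> : r `^ (2 - q) = r * r `^ (1 - q).
  rewrite -[X in _ = X * _]powRr1 ?ltW// -powRD ?lt0r_neq0 ?implybT//.
  by congr (_ `^ _); ring.
have -> : p%:R ^+ 2 * Lam * (3 * B) * B `^ (1 - q) * (r * r `^ (1 - q)) =
    p%:R ^+ 2 * Lam * (2 * (B * r) + B * r) * (B * r) `^ (1 - q).
  by rewrite powRM ?(ltW r_gt0)//; ring.
rewrite ler_pM ?powR_ge0 ?mulr_ge0 ?sqr_ge0 ?addr_ge0 ?mulr_ge0//.
  by rewrite ler_wpM2l ?mulr_ge0 ?sqr_ge0// lerD// ler_wpM2l.
by rewrite ge0_ler_powR ?nnegrE ?subr_ge0 ?mulr_ge0 ?(ltW r_gt0).
Qed.

End lsa_deterministic.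

(** By [symposdef_coercive], [A] is coercive with constant c^(-2). The perturbation [B - A] consumes
    at most half of it, and the other half remains for [B]. *)
Lemma symposdef_coercive_near (R : realType) (p : nat) (A B : 'M[R]_p) (c : R)
    (x : 'cV[R]_p) : symposdef A -> 0 < c -> 1 <= c * `|\det A| ->
  `|\adj A| <= c -> p%:R ^+ 2 * `|B - A| <= (2 * c ^+ 2)^-1 ->
  (2 * c ^+ 2)^-1 * `|x| ^+ 2 <= bform B x x.
Proof.
move=> pA c_gt0 detA adjA BA.
have c2_gt0 : 0 < c ^+ 2 by rewrite exprn_gt0.
have hA : `|x| ^+ 2 <= c ^+ 2 * bform A x x.
  apply: (@le_trans _ _ (c * `|\det A| * `|x| ^+ 2)).
    by rewrite ler_peMl// sqr_ge0.
  rewrite -mulrA expr2 -mulrA ler_pM2l// (le_trans (symposdef_coercive x pA))//.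
  by rewrite ler_wpM2r// symposdef_ge0.
have hB : - ((2 * c ^+ 2)^-1 * `|x| ^+ 2) <= bform (B - A) x x.
  rewrite lerNl (le_trans (ler_norm _))// normrN (le_trans (ler_norm_bform _ _ _))//.
  by rewrite -mulrA -expr2 ler_wpM2r// sqr_ge0.
rewrite -[B](subrK A) bformDm.
have : (c ^+ 2)^-1 * `|x| ^+ 2 <= bform A x x by rewrite ler_pdivrMl.
have -> : (c ^+ 2)^-1 = (2 * c ^+ 2)^-1 + (2 * c ^+ 2)^-1.
  by field; exact: lt0r_neq0.
move: (`|x| ^+ 2) hB => y; lra.
Qed.

(** * Events of probability close to one *)

Section likely.
Context d (Omega : measurableType d) (R : realType) (P : probability Omega R).
Implicit Types (A B : set Omega) (e : R).

(* A need not be measurable: P is only controlled on measurable sets. *)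
Definition likely e A : Prop :=
  exists B, [/\ measurable B, (P B <= e%:E)%E & ~` A `<=` B].

Lemma likelyS e A B : A `<=` B -> likely e A -> likely e B.
Proof.
move=> AB [N [mN PN AN]]; exists N; split => //.
by apply: subset_trans AN; exact: subsetC.
Qed.

Lemma likelyI e1 e2 A B :
  likely e1 A -> likely e2 B -> likely (e1 + e2) (A `&` B).
Proof.
move=> [N1 [mN1 PN1 AN1]] [N2 [mN2 PN2 AN2]]; exists (N1 `|` N2); split.
- exact: measurableU.
- rewrite EFinD (le_trans (measureU2 _ _ _))//; exact: leeD.
- by rewrite setCI; exact: setUSS.
Qed.

Lemma likely_ae A : {ae P, forall w, A w} -> likely 0 A.
Proof. by move=> [N [mN PN AN]]; exists N; split => //; rewrite PN. Qed.

Lemma likelyC e A : measurable A -> (P A <= e%:E)%E -> likely e (~` A).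
Proof. by move=> mA PA; exists A; split => //; rewrite setCK. Qed.

Lemma likelyE e A : measurable A -> likely e A <-> ((1 - e)%:E <= P A)%E.
Proof.
move=> mA; have PAfin : P A \is a fin_num by exact: fin_num_measure.
split=> [[N [mN PN AN]]|PA].
  have : (P (~` A) <= e%:E)%E.
    by apply: le_trans PN; apply: le_measure; rewrite ?inE//; exact: measurableC.
  by rewrite probability_setC// -(fineK PAfin) -EFinB !lee_fin; lra.
rewrite -[A]setCK; apply: likelyC; first exact: measurableC.
by rewrite probability_setC//; move: PA; rewrite -(fineK PAfin) -EFinB !lee_fin; lra.
Qed.

(** Continuity from below: the probabilities of the [F n] increase to that of their union, which is
    1. *)
Lemma likely_bigcup (F : (set Omega)^nat) e : 0 < e ->
  (forall n, measurable (F n)) -> {homo F : m n / (m <= n)%N >-> m `<=` n} ->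
  {ae P, forall w, exists n, F n w} -> exists n, likely e (F n).
Proof.
move=> e_gt0 mF ndF aeF.
have mU : measurable (\bigcup_n F n) by exact: bigcupT_measurable.
have PU : P (\bigcup_n F n) = 1%E.
  apply/eqP; rewrite eq_le probability_le1//=.
  have : likely 0 (\bigcup_n F n).
    by apply: likely_ae; apply: filterS aeF => w [n Fnw]; exists n.
  by move/(likelyE _ mU); rewrite subr0.
have : P (F n) @[n --> \oo] --> 1%E.
  rewrite -PU; apply: nondecreasing_cvg_mu => // m n mn.
  by apply/subsetPset; exact: ndF.
move=> /fine_cvgP[_ /cvgr_ge/(_ (1 - e))].
rewrite ltrBlDr ltrDl => /(_ e_gt0)[n _ /(_ n (leqnn n)) /= Fn].
exists n; apply/likelyE => //.
by rewrite -(fineK (fin_num_measure P _ (mF n))) lee_fin.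
Qed.

Context (I : Type) (F : set_system I) {FF : Filter F}.

(** This trades a limit of probabilities for a fixed error [e], so that finitely many events can be
    intersected by adding their errors. *)
Lemma likely_cvg1 (A : I -> set Omega) : (\near F, measurable (A F)) ->
  (P (A t) @[t --> F] --> 1%E) <-> (forall e, 0 < e -> \near F, likely e (A F)).
Proof.
move=> mA; split=> [/fine_cvgP[finA /cvgr_ge cvgA] e e_gt0|lA].
  near=> t; apply/likelyE; first by near: t.
  rewrite -[X in (_ <= X)%E]fineK ?lee_fin; last by near: t.
  by near: t; apply: cvgA; rewrite ltrBlDr ltrDl.
apply/fine_cvgP; split.
  by apply: filterS mA => t; exact: fin_num_measure.
apply/cvgrPdist_le => e e_gt0; near=> t.
have mAt : measurable (A t) by near: t.
have : likely e (A t) by near: t; exact: lA.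
have := probability_le1 P mAt; move=> /= + /(likelyE _ mAt).
rewrite -(fineK (fin_num_measure P _ mAt)) !lee_fin => h1 h2.
by rewrite ger0_norm; lra.
Unshelve. all: by end_near. Qed.

Lemma likely_cvg0 (A : I -> set Omega) : (\near F, measurable (A F)) ->
  P (A t) @[t --> F] --> 0%E ->
  forall e, 0 < e -> \near F, likely e (~` (A F)).
Proof.
move=> mA /fine_cvgP[finA /cvgr_le cvgA] e e_gt0; near=> t.
apply: likelyC; first by near: t.
by rewrite -[leLHS]fineK ?lee_fin; near: t => //; exact: cvgA.
Unshelve. all: by end_near. Qed.

End likely.

(** * Measurability of iterated operations, matrix norms, determinants and adjugates *)

Lemma measurable_bigop d d' (T : measurableType d) (U : measurableType d')
    (op : U -> U -> U) (idx : U) (I : Type) (s : seq I) (Q : pred I)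
    (f : I -> T -> U) :
  (forall g h : T -> U, measurable_fun setT g -> measurable_fun setT h ->
    measurable_fun setT (fun w => op (g w) (h w))) ->
  (forall i, Q i -> measurable_fun setT (f i)) ->
  measurable_fun setT (fun w => \big[op/idx]_(i <- s | Q i) f i w).
Proof.
move=> mop mf; elim: s => [|i s IH].
  by under eq_fun do rewrite big_nil; exact: measurable_cst.
under eq_fun do rewrite big_cons; case: (Q i) (mf i) => // /(_ isT) mfi.
exact: mop.
Qed.

Section random_matrix.
Context d (Omega : measurableType d) (R : realType).

Lemma measurable_gt_cst (f : Omega -> R) (c : R) :
  measurable_fun setT f -> measurable [set w | c < f w].
Proof.
move=> mf; rewrite -[X in measurable X]setTI.
by rewrite -preimage_itvoy; apply: mf => //; exact: measurable_itv.
Qed.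

Lemma measurable_le_cst (f : Omega -> R) (c : R) :
  measurable_fun setT f -> measurable [set w | f w <= c].
Proof.
move=> mf; rewrite -[X in measurable X]setTI.
by rewrite -preimage_itvNyc; apply: mf => //; exact: measurable_itv.
Qed.

Lemma measurable_normmx m n (X : Omega -> 'M[R]_(m, n)) :
  random_mx X -> measurable_fun setT (fun w => `|X w|).
Proof.
move=> mX; under eq_fun do rewrite [`|_|]mx_normrE.
apply: measurable_bigop => [g h mg mh|[i j] _]; first exact: measurable_maxr.
by apply: measurableT_comp => //; exact: mX.
Qed.

Lemma measurable_det n (X : Omega -> 'M[R]_n) :
  random_mx X -> measurable_fun setT (fun w => \det (X w)).
Proof.
move=> mX; apply: measurable_bigop => [g h|s _]; first exact: measurable_funD.
apply: measurable_funM => //.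
apply: measurable_bigop => [g h|i _]; first exact: measurable_funM.
exact: mX.
Qed.

Lemma random_mx_adj n (X : Omega -> 'M[R]_n) :
  random_mx X -> random_mx (fun w => \adj (X w)).
Proof.
move=> mX i j; under eq_fun do rewrite mxE.
apply: measurable_funM => //; apply: measurable_det => k l.
by under eq_fun do rewrite !mxE; exact: mX.
Qed.

Lemma random_mxB m n (X Y : Omega -> 'M[R]_(m, n)) :
  random_mx X -> random_mx Y -> random_mx (fun w => X w - Y w).
Proof.
move=> mX mY i j; under eq_fun do rewrite !mxE.
by apply: measurable_funB; [exact: mX|exact: mY].
Qed.

Lemma random_mx_cst m n (A : 'M[R]_(m, n)) : random_mx (fun _ : Omega => A).
Proof. by move=> i j; exact: measurable_cst. Qed.

Lemma random_mxZ m n (a : R) (X : Omega -> 'M[R]_(m, n)) :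
  random_mx X -> random_mx (fun w => a *: X w).
Proof.
move=> mX i j; under eq_fun do rewrite mxE.
by apply: measurable_funM => //; exact: mX.
Qed.

End random_matrix.

(** * High-probability bounds, and the limit theorem *)

Lemma symposdef_tight d (Omega : measurableType d) (R : realType)
    (P : probability Omega R) (p : nat) (G : Omega -> 'M[R]_p) (e : R) :
  random_mx G -> {ae P, forall w, symposdef (G w)} -> 0 < e ->
  exists2 c : R, 0 < c & likely P e [set w |
    [/\ 1 <= c * `|\det (G w)|, `|\adj (G w)| <= c & `|G w| <= c]].
Proof.
move=> mG pG e_gt0.
(* The limit matrix is random, so its determinant need not be bounded away from 0. These sets
   increase with n, and they exhaust almost every outcome because the determinant is almost surely
   nonzero. *)
pose F n := [set w | [/\ 1 <= n.+1%:R * `|\det (G w)|,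
  `|\adj (G w)| <= n.+1%:R & `|G w| <= n.+1%:R]].
(* The lower bound on the determinant is negated to make it a sublevel set, as [measurable_le_cst]
   requires. *)
have FE n : F n = [set w | - (n.+1%:R * `|\det (G w)|) <= - 1] `&`
    ([set w | `|\adj (G w)| <= n.+1%:R] `&` [set w | `|G w| <= n.+1%:R]).
  apply/seteqP; split=> w /=; first by case; rewrite lerN2.
  by case; rewrite lerN2 => ? [].
have [n Fn] : exists n, likely P e (F n).
  apply: likely_bigcup => //.
  - move=> n; rewrite FE; apply: measurableI; last apply: measurableI.
    + apply: measurable_le_cst; apply: measurableT_comp => //.
      apply: measurable_funM => //; apply: measurableT_comp => //.
      exact: measurable_det.
    + by apply: measurable_le_cst; apply: measurable_normmx; exact: random_mx_adj.
    + by apply: measurable_le_cst; exact: measurable_normmx.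
  - move=> m n mn w [h1 h2 h3].
    have le_mn : (m.+1%:R : R) <= n.+1%:R by rewrite ler_nat ltnS.
    split; [|exact: le_trans le_mn..].
    by rewrite (le_trans h1)// ler_wpM2r.
  - apply: filterS pG => w /symposdef_det_neq0; rewrite -normr_gt0 => det_gt0.
    pose y := Num.max (`|\det (G w)|^-1) (Num.max `|\adj (G w)| `|G w|).
    have [n ny] : exists n, y <= n.+1%:R.
      have y_ge0 : 0 <= y by rewrite le_max invr_ge0 normr_ge0.
      exists (Num.bound y); apply/ltW/(lt_le_trans (archi_boundP y_ge0)).
      by rewrite ler_nat.
    exists n; move: ny; rewrite /y !ge_max => /and3P[h1 h2 h3]; split => //.
    by rewrite -ler_pdivrMr// mul1r.
by exists n.+1%:R.
Qed.

Lemma bounded_in_prob_likely d (Omega : measurableType d) (R : realType)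
    (P : probability Omega R) (I : Type) (F : set_system I) {FF : Filter F}
    (V : normedZmodType R) (X : I -> Omega -> V) (e : R) :
  (\near F, measurable_fun setT (fun w => `|X F w|)) ->
  bounded_in_prob P F X -> 0 < e ->
  exists M, \near F, likely P e [set w | `|X F w| <= M].
Proof.
move=> mX bX /bX[M PM]; exists M; near=> t.
have : likely P e (~` [set w | M < `|X t w|]).
  by apply: likelyC; [apply: measurable_gt_cst|]; near: t.
by apply: likelyS => w /negP; rewrite -leNgt.
Unshelve. all: by end_near. Qed.

(* The index T runs through a set TT of real numbers that is unbounded above
   (e.g. all positive reals, or the natural numbers), and the limits are taken
   as T tends to +oo inside TT. *)
Theorem theorem2 (R : realType) (d : measure_display) (Omega : measurableType d)
  (P : probability Omega R)
  (TT : set R) (TT_unbounded : forall M : R, exists2 T : R, TT T & M < T)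
  (p p0 : nat) (p_gt0 : (0 < p)%N) (p0_le_p : (p0 <= p)%N)
  (q : R) (q_gt0 : 0 < q) (q_le1 : q <= 1)
  (r : R -> R) (r_gt0 : forall T : R, TT T -> 0 < r T)
  (r_cvg0 : r T @[T --> within TT (pinfty_nbhs R)] --> (0 : R))
  (thetas : 'cV[R]_p)
  (thetas_active : forall j : 'I_p, (j < p0)%N -> thetas j 0 != 0)
  (thetas_inactive : forall j : 'I_p, (p0 <= j)%N -> thetas j 0 = 0)
  (thetat : R -> Omega -> 'cV[R]_p)
  (thetat_rv : forall T : R, TT T -> random_mx (thetat T))
  (Ghat : R -> Omega -> 'M[R]_p)
  (Ghat_rv : forall T : R, TT T -> random_mx (Ghat T))
  (Ghat_posdef : forall T : R, TT T -> \forall w \ae P, symposdef (Ghat T w))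
  (kappa : R -> 'I_p -> Omega -> R)
  (kappa_rv : forall (T : R) (j : 'I_p), TT T -> measurable_fun setT (kappa T j))
  (kappa_ge0 : forall (T : R) (j : 'I_p) (w : Omega), TT T -> 0 <= kappa T j w)
  (thetahat : R -> Omega -> 'cV[R]_p)
  (thetahat_rv : forall T : R, TT T -> random_mx (thetahat T))
  (thetahat_min : forall T : R, TT T -> \forall w \ae P,
     forall theta : 'cV[R]_p,
       penalized_lsa q (Ghat T w) (thetat T w) (fun j => kappa T j w)
         (thetahat T w)
       <= penalized_lsa q (Ghat T w) (thetat T w) (fun j => kappa T j w) theta)
  (G : Omega -> 'M[R]_p) (G_rv : random_mx G)
  (G_posdef : \forall w \ae P, symposdef (G w))
  (Ghat_cvg : cvg_in_prob P (within TT (pinfty_nbhs R)) Ghat G)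
  (thetat_bounded : bounded_in_prob P (within TT (pinfty_nbhs R))
     (fun T w => (r T)^-1 *: (thetat T w - thetas)))
  (a_bounded : bounded_in_prob P (within TT (pinfty_nbhs R))
     (fun T w => (r T)^-1 * max_active p0 (fun j => kappa T j w)))
  (b_cvg : cvg_pinfty_in_prob P (within TT (pinfty_nbhs R))
     (fun T w => ((r T `^ (- (2 - q)))%:E
                  * min_inactive p0 (fun j => kappa T j w))%E)) :
  P [set w | forall j : 'I_p, (p0 <= j)%N -> thetahat T w j 0 = 0]
    @[T --> within TT (pinfty_nbhs R)] --> 1%E.
Proof.
pose F := within TT (pinfty_nbhs R).
have FF : Filter F by exact: within_filter.
have TTF : \near F, TT F by exact: withinT.
apply: (likely_cvg1 P _).2.
  apply: filterS TTF => T TTT.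
  rewrite [X in measurable X](_ : _ = \bigcap_(j in [set j : 'I_p | (p0 <= j)%N])
      [set w | thetahat T w j 0 = 0]); last first.
    by apply/seteqP; split => w /= h j; exact: h.
  apply: fin_bigcap_measurable => [|j _]; first exact: finite_finset.
  rewrite -[X in measurable X]setTI.
  have := thetahat_rv _ TTT j 0 measurableT [set 0] (measurable_set1 _). exact.
(* Five events cost e/5 each: the bounds on the initial estimator and on a_T, the closeness of
   [Ghat] to [G], the lower bound on b_T, and the tightness of [G]. The two almost sure events cost
   0. *)
move=> e e_gt0; pose e5 := e / 5; have e5_gt0 : 0 < e5 by rewrite divr_gt0.
have mt : \near F, measurable_fun setT (fun w => `|(r F)^-1 *: (thetat F w - thetas)|).
  apply: filterS TTF => T TTT; apply/measurable_normmx/random_mxZ/random_mxB.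
    exact: thetat_rv.
  exact: random_mx_cst.
have ma : \near F, measurable_fun setT
    (fun w => `|(r F)^-1 * max_active p0 (fun j => kappa F j w)|).
  apply: filterS TTF => T TTT; apply: measurableT_comp => //.
  apply: measurable_funM => //; apply: measurable_bigop => [f g|j _].
    exact: measurable_maxr.
  exact: kappa_rv.
have mb (N : R) : \near F, measurable [set w | (N%:E <
    (r F `^ (- (2 - q)))%:E * min_inactive p0 (fun j => kappa F j w))%E].
  apply: filterS TTF => T TTT; rewrite -[X in measurable X]setTI.
  apply: emeasurable_fun_o_infty => //; apply: measurable_funeM.
  apply: measurable_bigop => [f g|j _]; first exact: measurable_mine.
  by apply/measurable_EFinP; exact: kappa_rv.
have [M1 hM1] := bounded_in_prob_likely mt thetat_bounded e5_gt0.
have [M2 hM2] := bounded_in_prob_likely ma a_bounded e5_gt0.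
pose M := Num.max 0 (Num.max M1 M2).
have [M_ge0 M1M M2M] : [/\ 0 <= M, M1 <= M & M2 <= M].
  by split; rewrite /M !le_max lexx ?orbT.
have [c c_gt0 hc] := symposdef_tight G_rv G_posdef e5_gt0.
pose lam := (2 * c ^+ 2)^-1.
have lam_gt0 : 0 < lam by rewrite invr_gt0 mulr_gt0// exprn_gt0.
have p2_gt0 : 0 < p%:R ^+ 2 :> R by rewrite exprn_gt0// ltr0n.
(* The bound 1 keeps the norm of [Ghat] below [c + 1], which is [Lam]. The other bound is the
   perturbation allowed by [symposdef_coercive_near], so that [Ghat] is coercive with constant
   [lam]. *)
pose delta := Num.min 1 (lam / p%:R ^+ 2).
have delta_gt0 : 0 < delta by rewrite lt_min ltr01 divr_gt0.
have mG : \near F, measurable [set w | delta < `|Ghat F w - G w|].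
  apply: filterS TTF => T TTT; apply/measurable_gt_cst/measurable_normmx.
  by apply: random_mxB => //; exact: Ghat_rv.
pose Lam := c + 1; have Lam_ge0 : 0 <= Lam by rewrite addr_ge0// ltW.
(* This level is free of T, so the divergence of the scaled b_T applies to it. *)
pose N := lsa_threshold q lam Lam M p0 thetas.
have hG := likely_cvg0 (FF := FF) mG (Ghat_cvg delta delta_gt0) e5_gt0.
have hN := (likely_cvg1 P (FF := FF) (mb N)).1 (b_cvg N) e5 e5_gt0.
apply: filterS (filterI (filterI TTF (filterI hM1 hM2)) (filterI hG hN)).
move=> T [[TTT [lM1 lM2]] [lG lN]].
have rT_gt0 := r_gt0 _ TTT.
have -> : e = e5 + e5 + (e5 + e5) + e5 + (0 + 0) by rewrite /e5; field.
apply: likelyS (likelyI (likelyI (likelyI (likelyI lM1 lM2) (likelyI lG lN)) hc)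
  (likelyI (likely_ae (thetahat_min _ TTT)) (likely_ae G_posdef))).
move=> w [[[[/= near1 near2] [/= /negP near3 near4]] [/= detG adjG G_le]] [/= minw pGw]].
rewrite -leNgt in near3.
have [d1 dlam] : delta <= 1 /\ delta <= lam / p%:R ^+ 2.
  by split; rewrite /delta ge_min lexx ?orbT.
(* The bound on the smallest inactive weight passes to every inactive weight, after undoing the
   scaling by r^(-(2-q)). *)
have minE (j : 'I_p) : (p0 <= j)%N -> N * r T `^ (2 - q) < kappa T j w.
  move=> jp0; rewrite -ltr_pdivlMr ?powR_gt0// -powRN mulrC -lte_fin.
  apply: lt_le_trans near4 _.
  rewrite EFinM; apply: lee_wpmul2l; first by rewrite lee_fin powR_ge0.
  exact: (bigmin_le_cond _ (fun j => (kappa T j w)%:E)).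
have actE (j : 'I_p) : (j < p0)%N -> kappa T j w <= M * r T.
  move=> jp0; rewrite -ler_pdivrMr// mulrC (le_trans _ M2M)// (le_trans _ near2)//.
  rewrite (le_trans _ (ler_norm _))// ler_wpM2l ?invr_ge0 ?(ltW rT_gt0)//.
  exact: (le_bigmax_cond _ (fun j => kappa T j w)).
move=> j jp0.
apply: (lsa_sparse q_gt0 q_le1 lam_gt0 Lam_ge0 M_ge0 thetas_active
  thetas_inactive rT_gt0 _ _ _ _ actE minw jp0 (minE j jp0)).
- rewrite -[Ghat T w](subrK (G w)) addrC (le_trans (ler_normD _ _))// lerD//.
  exact: le_trans near3 d1.
- move=> x; apply: (symposdef_coercive_near x pGw) => //.
  by rewrite mulrC -ler_pdivlMr// (le_trans near3).
- move: near1; rewrite normrZ gtr0_norm ?invr_gt0// mulrC ler_pdivrMr// => /le_trans.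
  by apply; rewrite ler_wpM2r// ltW.
- by move=> k; exact: kappa_ge0.
Qed.
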